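(* Let $(\theta_t)_{t\in\mathbb R}$ be a smooth green path and $M\in\mathcal G$. Then there exist real numbers $t_1>t_2>\cdots>t_m$ and strict subobjects $M=M_0\supseteq M_1\supseteq\cdots\supseteq M_m=0$ of $M$ such that $M_{k-1}/M_k\in\mathcal W(\theta_{t_k})$ for $k=1,\dots,m$. Furthermore, each quotient $M_{k-1}/M_k$ has a chain of strict subobjects $0=N_0\subseteq N_1\subseteq\cdots\subseteq N_r=M_{k-1}/M_k$ with every $N_j/N_{j-1}\in\mathcal W_0(\theta_{t_k})$.
   Context: Let $\Lambda$ be a finite dimensional algebra over a field with $n$ isoclasses of simple modules, and $\mathrm{mod}\text-\Lambda$ the category of finitely generated right $\Lambda$-modules. Fix a torsion class $\mathcal G\subseteq\mathrm{mod}\text-\Lambda$ (closed under isomorphisms, extensions and quotients). For $B\in\mathcal G$, a subobject of $B$ is a submodule in $\mathcal G$; a subobject $A\subseteq B$ is strict if $A\cap B'\in\mathcal G$ for every subobject $B'$ of $B$; a strict quotient of $B$ is $B/A$ with $A$ a strict subobject. Let $V_\Lambda=\mathrm{Hom}_{\mathbb Z}(K_0\Lambda,\mathbb R)\cong\mathbb R^n$; $\theta(M)$ denotes $\theta$ applied to the dimension vector of $M$. For $M\in\mathcal G$, $D_{\mathcal G}(M)$ is the set of $\theta$ with $\theta(M)=0$ and $\theta(M')\le0$ for every strict subobject $M'$ of $M$. $\mathcal W(\theta)$ is the class of $X\in\mathcal G$ with $\theta\in D_{\mathcal G}(X)$, and $\mathcal W_0(\theta)$ is the class of nonzero $X\in\mathcal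 W(\theta)$ such that no nonzero proper strict subobject of $X$ lies in $\mathcal W(\theta)$. A smooth green path is a smooth map $t\mapsto\theta_t$, $\mathbb R\to V_\Lambda$, such that: (1) whenever $\theta_{t_0}\in D_{\mathcal G}(M)$ for some nonzero $M\in\mathcal G$, $\frac{d}{dt}\theta_t(M)|_{t=t_0}>0$; (2) there is $T$ such that $\theta_t(M)>0$ for all $t>T$ and all nonzero $M\in\mathcal G$; (3) there is $T'$ such that $\theta_t(M)<0$ for all $t<T'$ and all nonzero $M\in\mathcal G$. *)

(* Defs.v *)
From HB Require Import structures.
From mathcomp Require Import all_boot all_order all_algebra all_field.
From Stdlib Require Import Reals.
From Coquelicot Require Import Coquelicot.

Set Implicit Arguments.
Unset Strict Implicit.
Unset Printing Implicit Defensive.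

Import GRing.Theory.
Local Open Scope ring_scope.

Section Modules.
Variables (F : fieldType) (A : falgType F).

(* A finite-dimensional right A-module: the space of row vectors 'rV_mdim,
   with v . a := v *m mrep a.  Validity is the predicate is_module. *)
Record module := Module { mdim : nat; mrep : A -> 'M[F]_mdim }.

Definition is_module (X : module) : Prop :=
  [/\ (forall (c : F) (a b : A), mrep X (c *: a + b) = c *: mrep X a + mrep X b),
      mrep X 1 = 1%:M
    & forall a b : A, mrep X (a * b) = mrep X a *m mrep X b].

(* submodules of X = subspaces of 'rV_(mdim X) (given by the row space of a
   square matrix) stable under the action *)
Definition stable (X : module) (U : 'M[F]_(mdim X)) : Prop :=
  forall a : A, (U *m mrep X a <= U)%MS.

(* the subquotient W/U (for U <= W stable), on a chosen basis of a
   complement of U in W *)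
Definition subquot (X : module) (W U : 'M[F]_(mdim X)) : module :=
  let C := (W :\: U)%MS in
  @Module (\rank C)
    (fun a => row_base C *m mrep X a *m proj_mx C U *m pinvmx (row_base C)).

Definition sub (X : module) (U : 'M[F]_(mdim X)) : module := subquot U 0.
Definition quo (X : module) (U : 'M[F]_(mdim X)) : module := subquot 1%:M U.

Definition iso (X Y : module) : Prop :=
  exists (P : 'M[F]_(mdim X, mdim Y)) (Q : 'M[F]_(mdim Y, mdim X)),
    [/\ P *m Q = 1%:M, Q *m P = 1%:M
      & forall a : A, mrep X a *m P = P *m mrep Y a].

Definition nonzero (X : module) : Prop := (0 < mdim X)%nat.

Definition torsion_class (G : module -> Prop) : Prop :=
  [/\ forall X, G X -> is_module X,
      forall X Y, is_module Y -> iso X Y -> G X -> G Y,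
      forall X (U : 'M[F]_(mdim X)), is_module X -> stable U -> G (sub U) -> G (quo U) -> G X
    & forall X (U : 'M[F]_(mdim X)), G X -> stable U -> G (quo U)].

(* elements of V_Lambda = Hom(K_0 Lambda, R): functions on modules that are
   invariant under isomorphism and additive on short exact sequences *)
Definition additive (th : module -> R) : Prop :=
  (forall X Y, is_module X -> is_module Y -> iso X Y -> th X = th Y) /\
  (forall X (U : 'M[F]_(mdim X)), is_module X -> stable U -> th X = Rplus (th (sub U)) (th (quo U))).

Variable G : module -> Prop.

Definition subobject (B : module) (U : 'M[F]_(mdim B)) : Prop :=
  stable U /\ G (sub U).

Definition strict_sub (B : module) (U : 'M[F]_(mdim B)) : Prop :=
  subobject U /\ forall V : 'M[F]_(mdim B), subobject V -> G (sub (U :&: V)%MS).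

Definition DG (X : module) (th : module -> R) : Prop :=
  th X = R0 /\ forall U : 'M[F]_(mdim X), strict_sub U -> Rle (th (sub U)) R0.

Definition W (th : module -> R) (X : module) : Prop := G X /\ DG X th.

Definition W0 (th : module -> R) (X : module) : Prop :=
  [/\ nonzero X, W th X
    & forall U : 'M[F]_(mdim X), strict_sub U -> U != 0 -> ~~ (1%:M <= U)%MS ->
        ~ W th (sub U)].

Definition smooth_green_path (theta : R -> module -> R) : Prop :=
  [/\ forall t, additive (theta t),
      forall X, is_module X -> forall (k : nat) (t : R),
        ex_derive_n (fun s => theta s X) k t,
      forall (t0 : R) X, is_module X -> G X -> nonzero X -> DG X (theta t0) ->
        Rgt (Derive (fun s => theta s X) t0) R0,
      exists T : R, forall t, Rgt t T -> forall X, is_module X -> G X -> nonzero X ->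
        Rgt (theta t X) R0
    & exists T' : R, forall t, Rlt t T' -> forall X, is_module X -> G X -> nonzero X ->
        Rlt (theta t X) R0].

End Modules.

(* Main.v *)
Require Import Defs.
From HB Require Import structures.
From mathcomp Require Import all_boot all_order all_algebra all_field.
From Stdlib Require Import Reals Lra Classical.
From Coquelicot Require Import Coquelicot.
Local Open Scope ring_scope.

(** Strict subobjects are closed under intersection with subobjects, under
    transitivity, and under lifting along M -> M/C for C strict, so everything
    takes place in the poset of strict subobjects of M.  For N strict and nonzero,
    let t1 be the infimum of the times at which theta is positive on all nonzero
    strict quotients of N.  Only finitely many functions t |-> theta_t(N/C) occur,
    so t1 is attained: at t1 all strict quotients are >= 0 and some vanish; any
    that vanishes is in W(theta_t1).  Take N/C vanishing with C of least dimension.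
    Then all nonzero strict quotients of C are positive at t1.  By the green
    condition they stay positive later (at a first zero the derivative would be
    both <= 0 and > 0), so the time attached to C is < t1, and one iterates with C.
    An object X of W(theta) is filtered from below: a nonzero strict subobject in
    W(theta) of least dimension is in W_0(theta), and its quotient is in W(theta). *)

Set Implicit Arguments.
Unset Strict Implicit.
Unset Printing Implicit Defensive.
Import GRing.Theory.

(** * Families of functions that can only become positive *)

Section Families.
Local Open Scope R_scope.
Variables (I : Type) (P : I -> Prop) (f : I -> R -> R) (l : list (R -> R)).
Hypothesis f_fin : forall i, P i -> exists2 g, List.In g l & forall t, f i t = g t.
Hypothesis f_ex_derive : forall i t, P i -> ex_derive (f i) t.

Definition all_pos t := forall i, P i -> 0 < f i t.

Lemma continuous_pos_near (g : R -> R) t :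
  continuous g t -> 0 < g t ->
  exists2 e, 0 < e & forall s, Rabs (s - t) < e -> 0 < g s.
Proof.
move=> gc gt0.
have /gc [e He] : locally (g t) (fun y => 0 < y) by exact: open_gt.
by exists e; [exact: cond_pos | move=> s /He].
Qed.

(** Only finitely many functions occur, so the least of their continuity radii works; the induction
    skips listed functions that no member of the family realizes. *)
Lemma all_pos_near t : all_pos t ->
  exists2 e, 0 < e & forall s, Rabs (s - t) < e -> all_pos s.
Proof.
move=> pos_t.
have [e e0 He] : exists2 e, 0 < e & forall s, Rabs (s - t) < e ->
    forall i g, P i -> List.In g l -> (forall t, f i t = g t) -> 0 < f i s.
  elim: l => [|g l' [e e0 He]]; first by exists 1; [lra | move=> s _ i g _ []].
  have [[i [Pi fig]]|noi] := classic (exists i, P i /\ forall t, f i t = g t).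
    have [e' e'0 He'] := continuous_pos_near (ex_derive_continuous _ _ (f_ex_derive t Pi)) (pos_t i Pi).
    exists (Rmin e e'); first exact: Rmin_glb_lt.
    move=> s Hs j h Pj [<-|hl'] fjh.
      rewrite fjh -fig; apply: He'; apply: Rlt_le_trans Hs _; exact: Rmin_r.
    by apply: (He _ _ j h) => //; apply: Rlt_le_trans Hs _; exact: Rmin_l.
  exists e => // s Hs j h Pj [<-|hl'] fjh; last exact: (He s Hs j h).
  by case: noi; exists j.
by exists e => // s Hs i Pi; have [g gl fig] := f_fin Pi; exact: (He s Hs i g).
Qed.

Lemma nonneg_limit (g : R -> R) t : continuous g t ->
  (forall e, 0 < e -> exists2 s, Rabs (s - t) < e & 0 <= g s) -> 0 <= g t.
Proof.
move=> gc H; apply: Rnot_lt_le => gt0.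
have [e e0 He] : exists2 e, 0 < e & forall s, Rabs (s - t) < e -> 0 < - g s.
  by apply: (@continuous_pos_near (fun x => - g x)); [exact: continuous_opp | lra].
by have [s /He] := H e e0; lra.
Qed.

(** Asked only where the whole family is nonnegative: for strict quotients a member vanishing there
    is semistable, and the green condition applies. *)
Hypothesis green : forall i t, P i -> (forall j, P j -> 0 <= f j t) ->
  f i t = 0 -> 0 < Derive (f i) t.

(* At the first time where positivity fails, some member of the family
   reaches 0 from above, so its derivative there cannot be positive. *)
Lemma all_pos_up t0 t : all_pos t0 -> t0 <= t -> all_pos t.
Proof.
move=> pos0 t0t; apply: NNPP => npos.
(* The supremum of [E] is the first time at which positivity fails. *)
pose E s := t0 <= s <= t /\ forall u, t0 <= u <= s -> all_pos u.
have [s [sub sleast]] : {s | is_lub E s}.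
  apply: completeness; first by exists t => s [[]].
  by exists t0; split=> [|u Hu]; [lra | have -> : u = t0 by lra].
have t0s : t0 <= s.
  by apply: sub; split=> [|u Hu]; [lra | have -> : u = t0 by lra].
have st : s <= t by apply: sleast => u [[]].
have below u : t0 <= u < s -> all_pos u.
  move=> Hu; apply: NNPP => npu.
  suff : s <= u by lra.
  apply: sleast => v [Hv Ev]; apply: Rnot_lt_le => uv.
  by apply: npu; apply: Ev; lra.
have nps : ~ all_pos s.
  move=> poss; have [e e0 He] := all_pos_near poss.
  have upto u : t0 <= u < s + e -> all_pos u.
    by move=> Hu; have [us|su] := Rlt_le_dec u s; [apply: below | apply: He; rewrite Rabs_pos_eq]; lra.
  have [ts|ts] := Rlt_le_dec t (s + e); first by apply: npos; apply: upto; lra.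
  suff : s + e / 2 <= s by lra.
  apply: sub; split=> [|u Hu]; first lra.
  by apply: upto; lra.
have t0lts : t0 < s.
  by case: (Rle_lt_or_eq_dec _ _ t0s) => // E0; case: nps; rewrite -E0.
have nn j : P j -> 0 <= f j s.
  move=> Pj; apply: nonneg_limit; first exact: (ex_derive_continuous _ _ (f_ex_derive s Pj)).
  move=> e e0; exists (Rmax t0 (s - e / 2)).
    have := Rmax_l t0 (s - e / 2); have := Rmax_r t0 (s - e / 2) => *.
    have : Rmax t0 (s - e / 2) < s by apply: Rmax_lub_lt; lra.
    by move=> ?; rewrite Rabs_left; lra.
  apply: Rlt_le; apply: below => //; split; first exact: Rmax_l.
  by apply: Rmax_lub_lt; lra.
have [i [Pi fi0]] : exists i, P i /\ f i s = 0.
  apply: NNPP => no; apply: nps => i Pi.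
  by case: (Rle_lt_or_eq_dec _ _ (nn i Pi)) => // E0; case: no; exists i.
have d0 := green Pi nn fi0.
have /is_derive_Reals D := Derive_correct _ _ (f_ex_derive s Pi).
(* With the derivative itself as tolerance, difference quotients for steps shorter than [d] are
   positive. The backward step [h] keeps [s + h] in [t0, s), where [f i] is positive, so its
   quotient is negative. *)
have [d Hd] := D (Derive (f i) s) d0.
pose h := - (Rmin (d / 2) ((s - t0) / 2)).
have dp := cond_pos d.
have m1 := Rmin_l (d / 2) ((s - t0) / 2).
have m2 := Rmin_r (d / 2) ((s - t0) / 2).
have m0 : 0 < Rmin (d / 2) ((s - t0) / 2) by apply: Rmin_glb_lt; lra.
have hn : h < 0 by rewrite /h; lra.
have fpos : 0 < f i (s + h) by apply: below => //; rewrite /h; lra.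
have := Hd h _ _.
rewrite fi0 => /(_ _ _)/Rabs_def2 [||Q1 Q2]; first lra.
  by rewrite Rabs_left /h; lra.
have : (f i (s + h) - 0) / h < 0.
  by rewrite Rminus_0_r; apply: Rdiv_pos_neg.
lra.
Qed.

(** The time is the supremum of the times at which positivity fails. It is itself such a time
    because [all_pos] is an open condition; nonnegativity there is a limit from the right. The last
    clause is the persistence of positivity, [all_pos_up]. *)
Lemma last_zero T T' : (exists i, P i /\ f i T' < 0) -> (forall t, T < t -> all_pos t) ->
  exists t1, [/\ forall i, P i -> 0 <= f i t1, exists i, P i /\ f i t1 = 0
    & forall t, all_pos t -> t1 < t].
Proof.
move=> [i0 [Pi0 neg]] posT.
have npos' : ~ all_pos T' by move=> /(_ i0 Pi0); lra.
have [s [sub sleast]] : {s | is_lub (fun t => ~ all_pos t) s}.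
  apply: completeness; last by exists T'.
  by exists T => t npt; apply: Rnot_lt_le => /posT.
have above t : s < t -> all_pos t.
  by move=> st; apply: NNPP => /sub; lra.
have nps : ~ all_pos s.
  move=> poss; have [e e0 He] := all_pos_near poss.
  suff : s <= s - e by lra.
  apply: sleast => t npt; apply: Rnot_lt_le => Ht; apply: npt.
  by have [ts|] := Rlt_le_dec s t; [exact: above | move=> ?; apply: He; rewrite Rabs_minus_sym Rabs_pos_eq; lra].
have nn j : P j -> 0 <= f j s.
  move=> Pj; apply: nonneg_limit; first exact: (ex_derive_continuous _ _ (f_ex_derive s Pj)).
  move=> e e0; exists (s + e / 2); first by rewrite Rabs_pos_eq; lra.
  by apply: Rlt_le; apply: above => //; lra.
exists s; split=> //.
  apply: NNPP => no; apply: nps => i Pi.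
  by case: (Rle_lt_or_eq_dec _ _ (nn i Pi)) => // E0; case: no; exists i.
move=> t post; apply: Rnot_le_lt => ts; apply: nps.
exact: all_pos_up post ts.
Qed.

End Families.

(** * Subquotients *)

Section Congruence.
Variables (F : fieldType) (n : nat) (U : 'M[F]_n).

(** Equality in the quotient by [U], tested on representatives so that no basis of the quotient is
    chosen. *)
Definition congmx m (x y : 'M[F]_(m, n)) := (x - y <= U)%MS.

Lemma congmx_refl m (x : 'M_(m, n)) : congmx x x.
Proof. by rewrite /congmx subrr sub0mx. Qed.

Lemma congmx_sym m (x y : 'M_(m, n)) : congmx x y -> congmx y x.
Proof. by rewrite /congmx -opprB eqmx_opp. Qed.

Lemma congmx_trans m (x y z : 'M_(m, n)) : congmx x y -> congmx y z -> congmx x z.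
Proof. by rewrite /congmx => xy yz; rewrite -(subrKA y) addmx_sub. Qed.

Lemma congmx_mull p m (v : 'M_(p, m)) (x y : 'M_(m, n)) :
  congmx x y -> congmx (v *m x) (v *m y).
Proof. by rewrite /congmx -mulmxBr; exact: mulmx_sub. Qed.

Lemma congmx_mulr m (x y : 'M_(m, n)) (B : 'M_n) :
  (U *m B <= U)%MS -> congmx x y -> congmx (x *m B) (y *m B).
Proof.
by rewrite /congmx -mulmxBl => sUB xy; apply: submx_trans sUB; exact: submxMr.
Qed.

Lemma congmx_lin m (c : F) (x y x' y' : 'M_(m, n)) :
  congmx x x' -> congmx y y' -> congmx (c *: x + y) (c *: x' + y').
Proof.
rewrite /congmx => xx yy; rewrite opprD addrACA -scalerBr.
by rewrite addmx_sub ?scalemx_sub.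
Qed.

Lemma congmx_submx m (x y : 'M_(m, n)) (V : 'M_n) :
  congmx x y -> (U <= V)%MS -> (y <= V)%MS -> (x <= V)%MS.
Proof.
move=> xy UV yV; rewrite -(subrK y x) addmx_sub //; exact: submx_trans xy UV.
Qed.

End Congruence.

(** * Subquotients presented by lifted bases *)

Section Presentations.
Variables (F : fieldType) (A : falgType F).
Implicit Types X Y Z : module A.

(* [i] identifies Y with the subquotient W/U of X: its rows lift to X a basis
   of Y.  Unlike [subquot], this depends only on the row spaces of W and U. *)
Definition presents X Y (W U : 'M[F]_(mdim X)) (i : 'M[F]_(mdim Y, mdim X)) : Prop :=
  [/\ (i + U :=: W)%MS,
      forall m (v : 'M_(m, mdim Y)), (v *m i <= U)%MS -> v = 0
    & forall a, congmx U (mrep Y a *m i) (i *m mrep X a)].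

Lemma presents_inj X Y W U (i : 'M_(mdim Y, mdim X)) m (v w : 'M_(m, _)) :
  presents W U i -> congmx U (v *m i) (w *m i) -> v = w.
Proof.
by case=> _ inj _; rewrite /congmx -mulmxBl => /inj /eqP; rewrite subr_eq0 => /eqP.
Qed.

(** The module laws hold in [X], hence modulo [U] for the lifted rows, and [presents_inj] cancels
    the lift. *)
Lemma presents_is_module X Y W U (i : 'M_(mdim Y, mdim X)) :
  is_module X -> stable U -> presents W U i -> is_module Y.
Proof.
move=> [Xlin X1 XM] sU pY; have [_ _ act] := pY.
split=> [c a b||a b]; apply: (presents_inj pY).
- apply: congmx_trans (act _) _; rewrite Xlin mulmxDr mulmxDl -scalemxAr -scalemxAl.
  by apply: congmx_lin; apply: congmx_sym.
- by apply: congmx_trans (act _) _; rewrite X1 mulmx1 mul1mx congmx_refl.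
- apply: congmx_trans (act _) _; rewrite XM mulmxA.
  apply: congmx_sym; rewrite -mulmxA; apply: congmx_trans (congmx_mull _ (act _)) _.
  by rewrite mulmxA; apply: congmx_mulr.
Qed.

(** Each lifted basis is a combination of the other modulo [U]; the coefficient matrices are
    mutually inverse isomorphisms. *)
Lemma presents_iso X Y Z W U (i : 'M_(mdim Y, mdim X)) (j : 'M_(mdim Z, mdim X)) :
  stable U -> presents W U i -> presents W U j -> iso Y Z.
Proof.
move=> sU pY pZ; have [iW _ iact] := pY; have [jW _ jact] := pZ.
have [P iP] : exists P, congmx U i (P *m j).
  have /sub_addsmxP[[P Q] /= ->] : (i <= j + U)%MS by rewrite jW -iW addsmxSl.
  by exists P; rewrite /congmx addrAC subrr add0r submxMl.
have [Q jQ] : exists Q, congmx U j (Q *m i).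
  have /sub_addsmxP[[Q P'] /= ->] : (j <= i + U)%MS by rewrite iW -jW addsmxSl.
  by exists Q; rewrite /congmx addrAC subrr add0r submxMl.
exists P, Q; split=> [||a].
- apply: (presents_inj pY); rewrite mul1mx -mulmxA; apply: congmx_sym.
  exact: congmx_trans iP (congmx_mull _ jQ).
- apply: (presents_inj pZ); rewrite mul1mx -mulmxA; apply: congmx_sym.
  exact: congmx_trans jQ (congmx_mull _ iP).
- apply: (presents_inj pZ); rewrite -!mulmxA.
  apply: congmx_trans (congmx_mull _ (congmx_sym iP)) _.
  apply: congmx_trans (iact a) _.
  apply: congmx_trans (congmx_mulr (sU a) iP) _.
  by rewrite -mulmxA; apply: congmx_mull; apply: congmx_sym.
Qed.

Lemma presents_subquot X (W U : 'M_(mdim X)) :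
  stable W -> (U <= W)%MS ->
  presents (Y := subquot W U) W U (row_base (W :\: U)%MS).
Proof.
move=> sW UW; set C := (W :\: U)%MS.
have CU0 : (C :&: U = 0)%MS by exact: capmx_diff.
have CUW : (C + U :=: W)%MS.
  apply: eqmx_trans (addsmx_diff_cap_eq W U); apply: adds_eqmx => //.
  by apply: eqmx_sym; apply/capmx_idPr.
split=> [|m v vU|a].
- by apply: eqmx_trans CUW; apply: adds_eqmx => //; exact: eq_row_base.
- have /row_free_inj inj := row_base_free C.
  apply: inj; rewrite mul0mx; apply/eqP; rewrite -submx0 -CU0 sub_capmx vU andbT.
  by apply: submx_trans (submxMl _ _) _; rewrite eq_row_base.
(* The action of [subquot] projects onto [C] along [U], so it differs from that of [X] only by a
   component in [U]. *)
- rewrite /= mulmxKpV; last by rewrite eq_row_base proj_mx_sub.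
  set x := row_base C *m mrep X a.
  have xCU : (x <= C + U)%MS.
    rewrite CUW; apply: submx_trans (sW a); apply: submxMr.
    by rewrite eq_row_base -CUW addsmxSl.
  rewrite /congmx -[X in _ - X](add_proj_mx CU0 xCU) -/C opprD addrA subrr sub0r.
  by rewrite eqmx_opp proj_mx_sub.
Qed.

Lemma presents_self X : presents (Y := X) 1%:M 0 1%:M.
Proof.
split=> [|m v|a]; first exact: addsmx0.
  by rewrite mulmx1 submx0 => /eqP.
by rewrite mulmx1 mul1mx congmx_refl.
Qed.

Lemma eqmx_presents X Y W U W' U' (i : 'M_(mdim Y, mdim X)) :
  (W :=: W')%MS -> (U :=: U')%MS -> presents W U i -> presents W' U' i.
Proof.
move=> WW UU [iW inj act]; split=> [|m v|a].
- apply: eqmx_trans WW; apply: eqmx_trans iW; apply: adds_eqmx => //; exact: eqmx_sym.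
- by rewrite -UU; exact: inj.
- by rewrite /congmx -UU; exact: act.
Qed.

(* The second isomorphism theorem B/(B :&: C) = (B + C)/C. *)
Lemma presents_second X Y B C (i : 'M_(mdim Y, mdim X)) :
  presents B (B :&: C)%MS i -> presents (B + C)%MS C i.
Proof.
move=> [iW inj act].
have iB : (i <= B)%MS by rewrite -iW addsmxSl.
split=> [|m v vC|a].
- apply/eqmxP/andP; split.
    by rewrite addsmxS.
  by rewrite addsmx_sub addsmxSr andbT -iW addsmxS ?capmxSr.
- by apply: inj; rewrite sub_capmx vC andbT; apply: submx_trans iB; exact: submxMl.
- by apply: submx_trans (act a) (capmxSr _ _).
Qed.

(** * Correspondence between submodules of W/U and submodules between U and W *)

Section Lift.
Variables (X Y : module A) (W U : 'M[F]_(mdim X)) (i : 'M[F]_(mdim Y, mdim X)).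
Hypotheses (sU : stable U) (pY : presents W U i).

(** The preimage in [W] of a submodule of [Y], seen as [W/U]. *)
Definition liftmx (V : 'M_(mdim Y)) : 'M_(mdim X) := (V *m i + U)%MS.

Lemma lift_ge V : (U <= liftmx V)%MS.
Proof. exact: addsmxSr. Qed.

Lemma lift_le V : (liftmx V <= W)%MS.
Proof.
case: pY => iW _ _; rewrite -iW addsmx_sub addsmxSr andbT.
by apply: submx_trans (submxMl _ _) (addsmxSl _ _).
Qed.

Lemma mulmx_lift m (v : 'M_(m, _)) V : (v *m i <= liftmx V)%MS = (v <= V)%MS.
Proof.
apply/idP/idP => [/sub_addsmxP[[x y] /= E]|vV].
  have -> : v = x *m V.
    by apply: (presents_inj pY); rewrite E -mulmxA /congmx addrAC subrr add0r submxMl.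
  exact: submxMl.
by apply: submx_trans (submxMr i vV) (addsmxSl _ _).
Qed.

Lemma liftmxS V V' : (liftmx V <= liftmx V')%MS = (V <= V')%MS.
Proof. by rewrite addsmx_sub lift_ge andbT mulmx_lift. Qed.

Lemma liftmx0 : (liftmx 0 :=: U)%MS.
Proof. by rewrite /liftmx mul0mx; exact: adds0mx. Qed.

Lemma liftmx1 : (liftmx 1%:M :=: W)%MS.
Proof. by rewrite /liftmx mul1mx; case: pY. Qed.

Lemma lift_cap V V' : (liftmx (V :&: V') :=: liftmx V :&: liftmx V')%MS.
Proof.
apply/eqmxP/andP; split; first by rewrite sub_capmx !liftmxS capmxSl capmxSr.
(* The intersection is [x V i + y U]. The part in [U] lies in both lifts, so the coordinates [x V]
   lie in [V] and in [V']. *)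
have /sub_addsmxP[[x y] /= E] := capmxSl (liftmx V) (liftmx V').
have Ui : forall V0, (y *m U <= liftmx V0)%MS.
  by move=> V0; apply: submx_trans (submxMl _ _) (lift_ge _).
have xV V0 : (liftmx V :&: liftmx V' <= liftmx V0)%MS -> (x *m V <= V0)%MS.
  move=> H; rewrite -mulmx_lift -mulmxA -(addrK (y *m U) (x *m (V *m i))) -E.
  by rewrite addmx_sub ?eqmx_opp.
rewrite E addmx_sub // mulmxA mulmx_lift sub_capmx !xV ?capmxSl ?capmxSr //.
Qed.

Lemma stable_lift V : stable V -> stable (liftmx V).
Proof.
case: pY => _ _ act sV a; rewrite addsmxMr addsmx_sub.
apply/andP; split; last by apply: submx_trans (sU a) (lift_ge _).
rewrite -mulmxA.
have := congmx_mull V (congmx_sym (act a)) => /congmx_submx; apply; first exact: lift_ge.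
by rewrite mulmxA mulmx_lift.
Qed.

Lemma stable_of_lift V : stable (liftmx V) -> stable V.
Proof.
case: pY => _ _ act sV a; rewrite -mulmx_lift -mulmxA.
have := congmx_mull V (act a) => /congmx_submx; apply; first exact: lift_ge.
by rewrite mulmxA; apply: submx_trans (sV a); apply: submxMr; exact: addsmxSl.
Qed.

Lemma lift_surj (V : 'M_(mdim X)) : (U <= V)%MS -> (V <= W)%MS -> exists V', (liftmx V' :=: V)%MS.
Proof.
case: pY => iW _ _ UV; rewrite -iW => /sub_addsmxP[[P Q] /= E].
(* [P] holds the coordinates of [V] along [i] modulo [U]; [<<P>>] is a square matrix with the same
   row space. *)
exists <<P>>%MS; apply/eqmxP/andP; split.
  rewrite addsmx_sub UV andbT (eqmxMr i (genmxE P)).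
  rewrite -(addrK (Q *m U) (P *m i)) -E addmx_sub // eqmx_opp.
  by apply: submx_trans UV; exact: submxMl.
rewrite {1}E addmx_sub //; last by apply: submx_trans (submxMl _ _) (lift_ge _).
by rewrite mulmx_lift genmxE.
Qed.

(** The third isomorphism theorem, with the two lifts composed. *)
Lemma presents_lift Z V' V (j : 'M_(mdim Z, mdim Y)) :
  presents V' V j -> presents (liftmx V') (liftmx V) (j *m i).
Proof.
move=> [jV jinj jact]; have [_ _ act] := pY; split=> [|m v|a].
- apply/eqmxP/andP; split.
    rewrite addsmx_sub liftmxS mulmx_lift -!jV addsmxSl addsmxSr //.
  rewrite addsmx_sub; apply/andP; split; last by apply: submx_trans (lift_ge V) (addsmxSr _ _).
  rewrite -(eqmxMr i jV) addsmxMr addsmxS // addsmxSl //.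
- by rewrite mulmxA mulmx_lift; exact: jinj.
- rewrite /congmx !mulmxA.
  have h1 : (mrep Z a *m j *m i - j *m mrep Y a *m i <= liftmx V)%MS.
    by rewrite -mulmxBl mulmx_lift; exact: jact.
  have h2 : (j *m mrep Y a *m i - j *m i *m mrep X a <= liftmx V)%MS.
    apply: submx_trans (lift_ge V); rewrite -!mulmxA; exact: congmx_mull.
  exact: (congmx_trans h1 h2).
Qed.

Lemma nonzeroP : Defs.nonzero Y <-> ~~ (W <= U)%MS.
Proof.
split=> [Y0|].
  apply/negP => WU; move: Y0; rewrite /Defs.nonzero.
  have : ((1%:M : 'M[F]_(mdim Y)) <= (0 : 'M[F]_(mdim Y)))%MS by rewrite -liftmxS liftmx0 liftmx1.
  by rewrite submx0 -mxrank_eq0 mxrank1 => /eqP->.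
rewrite /Defs.nonzero lt0n; apply: contraNneq => Y0.
rewrite -liftmx1 -liftmx0 liftmxS; apply/row_subP => k.
by have := ltn_ord k; rewrite {2}Y0.
Qed.

End Lift.
End Presentations.

(** * Torsion classes and strict subobjects *)

Section StableSubspaces.
Variables (F : fieldType) (A : falgType F) (X : module A).
Implicit Types U V W : 'M[F]_(mdim X).

Lemma stable0 : stable (0 : 'M[F]_(mdim X)).
Proof. by move=> a; rewrite mul0mx sub0mx. Qed.

Lemma stable1 : stable (1%:M : 'M[F]_(mdim X)).
Proof. by move=> a; rewrite submx1. Qed.

Lemma stable_cap U V : stable U -> stable V -> stable (U :&: V)%MS.
Proof.
move=> sU sV a; rewrite sub_capmx.
by rewrite (submx_trans (submxMr _ (capmxSl U V)) (sU a))
  (submx_trans (submxMr _ (capmxSr U V)) (sV a)).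
Qed.

Lemma stable_add U V : stable U -> stable V -> stable (U + V)%MS.
Proof.
move=> sU sV a; rewrite addsmxMr addsmx_sub.
by rewrite (submx_trans (sU a) (addsmxSl _ _)) (submx_trans (sV a) (addsmxSr _ _)).
Qed.

Lemma eqmx_stable U V : (U :=: V)%MS -> stable U -> stable V.
Proof. by move=> UV sU a; rewrite -UV -(eqmxMr _ UV). Qed.

Lemma subquot_is_module W U : is_module X -> stable W -> stable U -> (U <= W)%MS ->
  is_module (subquot W U).
Proof.
by move=> mX sW sU UW; apply: presents_is_module mX sU (presents_subquot sW UW).
Qed.

Lemma presents_subquot_lift (Y : module A) W U (i : 'M_(mdim Y, mdim X)) (V V' : 'M_(mdim Y)) :
  presents W U i -> stable V -> (V' <= V)%MS ->
  exists j, presents (Y := subquot V V') (liftmx U i V) (liftmx U i V') j.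
Proof.
by move=> pY sV V'V; have pj := presents_lift pY (presents_subquot sV V'V); exists (row_base (V :\: V')%MS *m i).
Qed.

Lemma presents_sub_lift (Y : module A) W U (i : 'M_(mdim Y, mdim X)) (V : 'M_(mdim Y)) :
  presents W U i -> stable V ->
  exists j, presents (Y := sub V) (liftmx U i V) U j.
Proof.
move=> pY sV; have [j pj] := presents_subquot_lift pY sV (sub0mx _ _).
by exists j; apply: eqmx_presents (eqmx_refl _) (liftmx0 U i) pj.
Qed.

End StableSubspaces.

Section TorsionClasses.
Variables (F : fieldType) (A : falgType F) (X : module A).
Implicit Types U V W : 'M[F]_(mdim X).

Lemma presents_quo_lift (Y : module A) W U (i : 'M_(mdim Y, mdim X)) (V : 'M_(mdim Y)) :
  presents W U i ->
  exists j, presents (Y := quo V) W (liftmx U i V) j.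
Proof.
move=> pY.
have [j pj] := presents_subquot_lift pY (@stable1 _ _ Y) (submx1 V).
by exists j; apply: eqmx_presents pj => //; exact: liftmx1.
Qed.

(** * Additive functions on subquotients *)

Section Additive.
Variable th : module A -> R.
Hypotheses (mX : is_module X) (th_add : Defs.additive th).

Lemma additive_presents Y W U (i : 'M_(mdim Y, mdim X)) :
  stable W -> stable U -> (U <= W)%MS -> presents W U i -> th Y = th (subquot W U).
Proof.
case: th_add => th_iso _ sW sU UW pY.
apply: th_iso; [exact: presents_is_module pY | exact: subquot_is_module |].
exact: presents_iso pY (presents_subquot sW UW).
Qed.

(** The axiom is applied to the submodule of [W/U] whose lift is [V]; its [sub] and [quo] present
    [V/U] and [W/V]. *)
Lemma additive_subquot W V U : stable W -> stable V -> stable U ->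
  (U <= V)%MS -> (V <= W)%MS ->
  th (subquot W U) = Rplus (th (subquot V U)) (th (subquot W V)).
Proof.
move=> sW sV sU UV VW; have UW := submx_trans UV VW.
have pS := presents_subquot sW UW.
have [V' lV] := lift_surj pS UV VW.
have sV' : stable V' by apply: (stable_of_lift pS); exact: eqmx_stable (eqmx_sym lV) sV.
case: (th_add) => _ /(_ _ V' (subquot_is_module mX sW sU UW) sV') ->.
have [j pj] := presents_sub_lift pS sV'.
have [k pk] := presents_quo_lift V' pS.
congr Rplus; apply: additive_presents => //.
  by apply: eqmx_presents pj.
by apply: eqmx_presents pk.
Qed.

Lemma additive_second (B C : 'M[F]_(mdim X)) : stable B -> stable C ->
  th (subquot B (B :&: C)%MS) = th (subquot (B + C)%MS C).
Proof.
move=> sB sC; apply: additive_presents => //; first exact: stable_add.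
  exact: addsmxSr.
apply: presents_second; apply: presents_subquot => //; exact: capmxSl.
Qed.

Lemma additive_subquot0 W U : stable W -> stable U -> (U == W)%MS -> th (subquot W U) = R0.
Proof.
move=> sW sU /eqmxP UW.
have /(presents_subquot sW) pS : (U <= W)%MS by rewrite UW.
have -> : th (subquot W U) = th (subquot W W).
  exact: additive_presents (submx_refl W) (eqmx_presents (eqmx_refl W) UW pS).
(* Additivity along [W <= W <= W] reads x = x + x. *)
have := additive_subquot sW sW sW (submx_refl W) (submx_refl W); lra.
Qed.

End Additive.

Variable G : module A -> Prop.
Hypotheses (tG : torsion_class G) (mX : is_module X).

Lemma torsion_presents Y W U (i : 'M_(mdim Y, mdim X)) :
  stable W -> stable U -> (U <= W)%MS -> presents W U i -> G Y <-> G (subquot W U).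
Proof.
case: tG => _ Giso _ _ sW sU UW pY; have pS := presents_subquot sW UW.
have mY := presents_is_module mX sU pY; have mS := presents_is_module mX sU pS.
by split; apply: Giso => //; [exact: presents_iso pY pS | exact: presents_iso pS pY].
Qed.

Lemma torsion_ext W V U : stable W -> stable V -> stable U ->
  (U <= V)%MS -> (V <= W)%MS ->
  G (subquot V U) -> G (subquot W V) -> G (subquot W U).
Proof.
move=> sW sV sU UV VW; have UW := submx_trans UV VW.
have pS := presents_subquot sW UW.
have [V' lV] := lift_surj pS UV VW.
have sV' : stable V' by apply: (stable_of_lift pS); exact: eqmx_stable (eqmx_sym lV) sV.
have [j pj] := presents_sub_lift pS sV'.
have [k pk] := presents_quo_lift V' pS.
rewrite -(torsion_presents sV sU UV (eqmx_presents lV (eqmx_refl U) pj)).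
rewrite -(torsion_presents sW sV VW (eqmx_presents (eqmx_refl W) lV pk)).
by case: tG => _ _ Gext _; apply: Gext => //; exact: subquot_is_module.
Qed.

Lemma torsion_quo W V U : stable W -> stable V -> stable U ->
  (U <= V)%MS -> (V <= W)%MS -> G (subquot W U) -> G (subquot W V).
Proof.
move=> sW sV sU UV VW; have UW := submx_trans UV VW.
have pS := presents_subquot sW UW.
have [V' lV] := lift_surj pS UV VW.
have sV' : stable V' by apply: (stable_of_lift pS); exact: eqmx_stable (eqmx_sym lV) sV.
have [k pk] := presents_quo_lift V' pS.
rewrite -(torsion_presents sW sV VW (eqmx_presents (eqmx_refl W) lV pk)).
by case: tG => _ _ _ Gquo GS; apply: Gquo.
Qed.

Lemma subobject_quo W V : subobject G W -> stable V -> (V <= W)%MS -> G (subquot W V).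
Proof.
move=> [sW GW] sV VW.
exact: (torsion_quo sW sV (@stable0 _ _ X) (sub0mx _ V) VW).
Qed.

Lemma torsion_second (B C : 'M[F]_(mdim X)) : stable B -> stable C ->
  G (subquot B (B :&: C)%MS) <-> G (subquot (B + C)%MS C).
Proof.
move=> sB sC; apply: torsion_presents => //; first exact: stable_add.
  exact: addsmxSr.
apply: presents_second; apply: presents_subquot => //; exact: capmxSl.
Qed.

(** By the second isomorphism theorem this is a quotient of [B]. *)
Lemma torsion_add_quo (B C : 'M[F]_(mdim X)) : stable C -> subobject G B -> G (subquot (B + C)%MS C).
Proof.
move=> sC [sB GB]; apply/torsion_second => //.
by apply: subobject_quo; [| exact: stable_cap | exact: capmxSl].
Qed.

(** Matrices with equal row spaces may lead [sub] to different bases, so closure of [G] under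
    isomorphism enters. *)
Lemma eqmx_subobject (B B' : 'M[F]_(mdim X)) : (B :=: B')%MS -> subobject G B -> subobject G B'.
Proof.
move=> BB [sB GB]; have sB' := eqmx_stable BB sB; split=> //.
have p := eqmx_presents BB (eqmx_refl _) (presents_subquot sB (sub0mx _ B)).
exact: (proj1 (torsion_presents sB' (@stable0 _ _ X) (sub0mx _ B') p)).
Qed.

Lemma eqmx_strict_sub (B B' : 'M[F]_(mdim X)) : (B :=: B')%MS -> strict_sub G B -> strict_sub G B'.
Proof.
move=> BB [sB GB]; split; first exact: eqmx_subobject BB sB.
move=> V sV; suff [] : subobject G (B' :&: V)%MS by [].
apply: (eqmx_subobject (cap_eqmx BB (eqmx_refl V))); split; last exact: GB.
by apply: stable_cap; [case: sB | case: sV].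
Qed.

Lemma strict_sub_cap (B V : 'M[F]_(mdim X)) : strict_sub G B -> subobject G V -> subobject G (B :&: V)%MS.
Proof.
by move=> [[sB _] GB] sV; split; [apply: stable_cap => //; case: sV | exact: GB].
Qed.

Lemma subobject1 : G X -> subobject G (1%:M : 'M_(mdim X)).
Proof.
move=> GX; split; first exact: stable1.
exact: (proj1 (torsion_presents (@stable1 _ _ X) (@stable0 _ _ X) (sub0mx _ _) (presents_self X))).
Qed.

Lemma strict_sub1 : G X -> strict_sub G (1%:M : 'M_(mdim X)).
Proof.
move=> GX; split=> [|V sV]; first exact: subobject1.
by rewrite cap1mx; case: sV.
Qed.

(* A zero module is the quotient of X by itself. *)
Lemma subobject0 : G X -> subobject G (0 : 'M_(mdim X)).
Proof.
move=> GX; split; first exact: stable0.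
have s0 := @stable0 _ _ X; have s1 := @stable1 _ _ X.
have G11 : G (subquot 1%:M (1%:M : 'M[F]_(mdim X))).
  exact: (subobject_quo (subobject1 GX) s1).
have [_ Giso _ _] := tG.
have pS := presents_subquot s1 (submx_refl (1%:M : 'M[F]_(mdim X))).
have pT := presents_subquot s0 (submx_refl (0 : 'M[F]_(mdim X))).
have rS : mdim (subquot 1%:M (1%:M : 'M[F]_(mdim X))) = 0%nat.
  by apply/eqP; rewrite -leqn0 leqNgt; apply/negP => /(nonzeroP pS); rewrite submx1.
have rT : mdim (subquot (0 : 'M[F]_(mdim X)) 0) = 0%nat.
  by apply/eqP; rewrite -leqn0 leqNgt; apply/negP => /(nonzeroP pT); rewrite sub0mx.
apply: Giso G11; first exact: presents_is_module mX s0 pT.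
by exists 0, 0; split=> [||a]; apply/matrixP => k; have := ltn_ord k; rewrite ?{2}rS ?{2}rT.
Qed.

Lemma strict_sub0 : G X -> strict_sub G (0 : 'M_(mdim X)).
Proof.
move=> GX; split=> [|V sV]; first exact: subobject0.
by rewrite cap0mx; case: (subobject0 GX).
Qed.

Lemma strict_torsion_quo (N C : 'M[F]_(mdim X)) : strict_sub G N -> strict_sub G C -> (C <= N)%MS ->
  G (subquot N C).
Proof.
by move=> [sN _] [[sC _] _]; exact: subobject_quo.
Qed.

End TorsionClasses.

(** * Strict subobjects of N/C and of X *)

Section Correspondence.
Variables (F : fieldType) (A : falgType F) (X : module A) (G : module A -> Prop).
Hypotheses (tG : torsion_class G) (mX : is_module X).
Variables (Y : module A) (N C : 'M[F]_(mdim X)) (i : 'M[F]_(mdim Y, mdim X)).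
Hypotheses (strC : strict_sub G C) (pY : presents N C i).

Let sC : stable C. Proof. by case: strC => [[]]. Qed.

(** The lift is an extension of [V] by [C], and both lie in [G]. *)
Lemma subobject_lift V : subobject G V -> subobject G (liftmx C i V).
Proof.
move=> [sV GV]; have slV := stable_lift sC pY sV; split=> //.
have [j pj] := presents_sub_lift pY sV.
apply: (@torsion_ext _ _ X G tG mX _ C) => //; rewrite ?sub0mx ?lift_ge //; first exact: stable0.
  by case: strC => [[]].
exact/(torsion_presents tG mX slV sC _ pj)/GV/lift_ge.
Qed.

Lemma subobject_of_lift V : subobject G (liftmx C i V) -> subobject G V.
Proof.
move=> [sV GV]; have sV' := stable_of_lift pY sV; split=> //.
have [j pj] := presents_sub_lift pY sV'.
apply/(torsion_presents tG mX sV sC _ pj); first exact: lift_ge.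
by apply: (subobject_quo tG mX) => //; exact: lift_ge.
Qed.

Lemma strict_sub_of_lift V : strict_sub G (liftmx C i V) -> strict_sub G V.
Proof.
move=> strV; split=> [|B sB]; first by apply: subobject_of_lift; case: strV.
suff [] : subobject G (V :&: B)%MS by [].
apply: subobject_of_lift; apply: eqmx_subobject (eqmx_sym (lift_cap pY V B)) _ => //.
by apply: strict_sub_cap => //; exact: subobject_lift.
Qed.

Hypothesis strN : strict_sub G N.

(** For a subobject [B], strictness of [N] puts [N :&: B] in [G], hence also its image in [Y], and
    strictness of [V] handles the intersection of [V] with that image. The lift meets [B] in an
    extension of this intersection by [C :&: B], which lies in [G] because [C] is strict. *)
Lemma strict_sub_lift V : strict_sub G V -> strict_sub G (liftmx C i V).
Proof.
move=> strV; have [sV GV] := strV; split=> [|B sB]; first exact: subobject_lift.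
have slV : stable (liftmx C i V) by case: (subobject_lift sV).
have [stB _] := sB.
have sNB : subobject G (N :&: B)%MS by exact: strict_sub_cap.
(* [B0/C] is the image in [Y] of the part of [B] inside [N]. *)
set B0 := (N :&: B + C)%MS.
have CN : (C <= N)%MS by case: pY => <- _ _; exact: addsmxSr.
have B0N : (B0 <= N)%MS by rewrite addsmx_sub CN capmxSl.
have sB0 : subobject G B0.
  split; first by apply: stable_add => //; case: sNB.
  apply: (@torsion_ext _ _ X G tG mX _ C); rewrite ?sub0mx ?addsmxSr //.
  - by apply: stable_add => //; case: sNB.
  - exact: stable0.
  - by case: strC => [[]].
  - exact: torsion_add_quo.
have [B' lB'] := lift_surj pY (addsmxSr _ _ : (C <= B0)%MS) B0N.
have sB' : subobject G B' by apply: subobject_of_lift; exact: eqmx_subobject (eqmx_sym lB') sB0.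
have [sVB GVB] := subobject_lift (strict_sub_cap strV sB').
have slVB : stable (liftmx C i V :&: B)%MS by exact: stable_cap.
(* For L the lift of V, (L :&: B)/(C :&: B) = ((L :&: B) + C)/C, and the latter
   numerator is the lift of V :&: B'. *)
apply: (@torsion_ext _ _ X G tG mX _ ((liftmx C i V :&: B) :&: C)%MS); rewrite ?sub0mx ?capmxSl //.
- exact: stable_cap.
- exact: stable0.
- have E : (C :&: B :=: (liftmx C i V :&: B) :&: C)%MS.
    apply/eqmxP/andP; split.
      by rewrite !sub_capmx capmxSl capmxSr (submx_trans (capmxSl C B)) // lift_ge.
    by rewrite !sub_capmx capmxSr (submx_trans (capmxSl _ C)) // capmxSr.
  by case: (eqmx_subobject tG mX E (strict_sub_cap strC sB)).
- apply/(torsion_second tG mX slVB sC).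
  have E : (liftmx C i (V :&: B') :=: (liftmx C i V :&: B) + C)%MS.
    apply: eqmx_trans (lift_cap pY V B') _.
    have lVN := lift_le pY V.
    apply/eqmxP/andP; split; last first.
      rewrite addsmx_sub !sub_capmx !lift_ge andbT capmxSl /= lB' !andbT.
      apply: submx_trans (addsmxSl _ _).
      by rewrite sub_capmx capmxSr (submx_trans (capmxSl _ _) lVN).
    (* Modular law: [C] lies in the lift of [V], so subtracting [y C] leaves [x (N :&: B)] inside
       that lift. *)
    have /sub_addsmxP[[x y] /= Exy] : (liftmx C i V :&: liftmx C i B' <= N :&: B + C)%MS.
      by rewrite -lB' capmxSr.
    rewrite Exy; apply: addmx_sub_adds; last exact: submxMl.
    rewrite sub_capmx (submx_trans (submxMl _ _) (capmxSr N B)) andbT.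
    have -> : x *m (N :&: B)%MS = (liftmx C i V :&: liftmx C i B')%MS - y *m C.
      by rewrite Exy addrK.
    rewrite addmx_sub ?capmxSl // eqmx_opp; apply: submx_trans (lift_ge _ _ _).
    exact: submxMl.
  have p := presents_subquot sVB (lift_ge C i (V :&: B')%MS).
  apply/(torsion_presents tG mX _ sC _ (eqmx_presents E (eqmx_refl C) p)).
  - exact: stable_add.
  - exact: addsmxSr.
  - by apply: (subobject_quo tG mX) => //; exact: lift_ge.
Qed.

Variable th : module A -> R.
Hypothesis th_add : Defs.additive th.

(** Strict subobjects of [Y] correspond to the strict [V] between [C] and [N], and [V/C] is
    presented by the matching submodule of [Y], so [th] takes the same values. *)
Lemma WP : W G th Y <-> th (subquot N C) = R0 /\
  forall V, strict_sub G V -> (C <= V)%MS -> (V <= N)%MS -> Rle (th (subquot V C)) R0.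
Proof.
have CN : (C <= N)%MS by case: pY => <- _ _; exact: addsmxSr.
have sN : stable N by case: strN => [[]].
have thY := additive_presents mX th_add sN sC CN pY.
have th_lift V : stable V -> th (sub V) = th (subquot (liftmx C i V) C).
  move=> sV; have [j pj] := presents_sub_lift pY sV.
  by apply: (additive_presents mX th_add _ _ _ pj) => //; [exact: (stable_lift sC pY sV) | exact: lift_ge].
split=> [[_ [Y0 Yle]]|[N0 Nle]].
  split=> [|V strV CV VN]; first by rewrite -thY.
  have [V' lV] := lift_surj pY CV VN.
  have strV' : strict_sub G V'.
    by apply: strict_sub_of_lift; exact: eqmx_strict_sub (eqmx_sym lV) strV.
  have sV' : stable V' by case: strV' => [[]].
  have [j pj] := presents_sub_lift pY sV'.
  have -> : th (subquot V C) = th (sub V').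
    symmetry; apply: (additive_presents mX th_add _ _ _ (eqmx_presents lV (eqmx_refl C) pj)) => //.
    by case: strV => [[]].
  exact: Yle.
split; first by apply/(torsion_presents tG mX sN sC CN pY); exact: strict_torsion_quo.
split=> [|V strV]; first by rewrite thY.
rewrite th_lift; last by case: strV => [[]].
by apply: Nle; [exact: strict_sub_lift | exact: lift_ge | exact: lift_le pY V].
Qed.

End Correspondence.

(** * Semistable subquotients and green paths *)

Section MinRank.
Variables (F : fieldType) (n : nat).

Lemma ex_min_rank (P : 'M[F]_n -> Prop) : (exists V, P V) ->
  exists2 V, P V & forall V', P V' -> (\rank V <= \rank V')%nat.
Proof.
suff H k V : (\rank V <= k)%nat -> P V ->
    exists2 V, P V & forall V', P V' -> (\rank V <= \rank V')%nat.
  by case=> V; exact: (H _ V (leqnn _)).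
elim: k V => [|k IHk] V rV PV.
  by exists V => // V' _; apply: leq_trans rV _.
have [[V' [PV' ltV]]|min] := classic (exists V', P V' /\ (\rank V' < \rank V)%nat).
  by apply: (IHk V') => //; rewrite -ltnS; apply: leq_trans rV.
exists V => // V' PV'; rewrite leqNgt; apply/negP => ltV.
by apply: min; exists V'.
Qed.

Lemma ltn_rank (U V : 'M[F]_n) : (U <= V)%MS -> ~~ (V <= U)%MS -> (\rank U < \rank V)%nat.
Proof.
move=> UV VU; rewrite ltn_neqAle mxrankS // andbT.
by rewrite (mxrank_leqif_sup UV).
Qed.

End MinRank.

Lemma strict_stable (F : fieldType) (A : falgType F) (X : module A) (G : module A -> Prop)
    (V : 'M_(mdim X)) : strict_sub G V -> stable V.
Proof. by case=> [[]]. Qed.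

Section Semistable.
Variables (F : fieldType) (A : falgType F) (X : module A) (G : module A -> Prop).
Hypotheses (tG : torsion_class G) (mX : is_module X).
Implicit Types B C N V : 'M[F]_(mdim X).

(** Membership of [N/C] in [W], expressed inside [X] as in [WP], so that iterated quotients keep one
    ambient module. *)
Definition semistable (th : module A -> R) N C : Prop :=
  th (subquot N C) = R0 /\
  forall V, strict_sub G V -> (C <= V)%MS -> (V <= N)%MS -> Rle (th (subquot V C)) R0.

Variable th : module A -> R.
Hypothesis th_add : Defs.additive th.

Lemma W_subquot N C : strict_sub G N -> strict_sub G C -> (C <= N)%MS ->
  semistable th N C -> W G th (subquot N C).
Proof.
move=> sN sC CN; have pS := presents_subquot (strict_stable sN) CN.
by move=> ss; apply/(WP tG mX sC pS sN th_add).
Qed.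

Lemma W0_subquot N C : strict_sub G N -> strict_sub G C -> (C <= N)%MS ->
  ~~ (N <= C)%MS -> semistable th N C ->
  (forall V, strict_sub G V -> (C <= V)%MS -> (V <= N)%MS -> ~~ (V <= C)%MS ->
    ~~ (N <= V)%MS -> ~ semistable th V C) ->
  W0 G th (subquot N C).
Proof.
move=> sN sC CN NC ss simple; have pS := presents_subquot (strict_stable sN) CN.
split; [exact/(nonzeroP pS) | exact: W_subquot |].
move=> U sU U0 U1 WU.
have [j pj] := presents_sub_lift pS (strict_stable sU).
have slU := strict_sub_lift tG mX sC pS sN sU.
apply: (simple _ slU _ _ _ _ (proj1 (WP tG mX sC pj slU th_add) WU)).
- exact: lift_ge.
- exact: lift_le pS U.
- rewrite -(liftmx0 C (row_base (N :\: C)%MS : 'M_(mdim (subquot N C), _))) (liftmxS pS).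
  by rewrite submx0.
- by rewrite -(liftmx1 pS) (liftmxS pS).
Qed.

(** Stated for an arbitrary lower end [N] so that the chain can be built upwards by induction on the
    codimension of [N]. *)
Lemma semistable_chain : G X -> forall N, strict_sub G N -> semistable th 1%:M N ->
  exists (r : nat) (Ns : nat -> 'M[F]_(mdim X)),
    [/\ Ns 0%nat = N, (Ns r == 1%:M)%MS,
        forall j, (j < r)%nat -> (Ns j <= Ns j.+1)%MS,
        forall j, (j <= r)%nat -> strict_sub G (Ns j)
      & forall j, (1 <= j)%nat -> (j <= r)%nat -> W0 G th (subquot (Ns j) (Ns j.-1))].
Proof.
move=> GX N; have [n] := ubnP (mdim X - \rank N).
elim: n N => // n IHn N ltn sN ssN.
have [N1|N1] := boolP (1%:M <= N)%MS.
  exists 0%nat, (fun _ => N); split=> //.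
  - by rewrite submx1.
  - by case.
pose P V := [/\ strict_sub G V, (N <= V)%MS, ~~ (V <= N)%MS & semistable th V N].
have [|V [sV NV VN ssV] minV] := @ex_min_rank _ _ P.
  by exists 1%:M; split=> //; [exact: strict_sub1 | exact: submx1].
have rNV := ltn_rank NV VN.
(* [th] vanishes on [V/N], so passing from [N] to [V] changes no value and preserves
   semistability. *)
have addV B : strict_sub G B -> (V <= B)%MS -> th (subquot B N) = th (subquot B V).
  move=> sB VB; have := additive_subquot mX th_add (strict_stable sB) (strict_stable sV) (strict_stable sN) NV VB.
  by case: ssV => -> _ ->; rewrite Rplus_0_l.
have ss1 : semistable th 1%:M V.
  case: ssN => N0 Nle; split=> [|B sB VB B1].
    by rewrite -addV ?submx1 //; exact: strict_sub1.
  by rewrite -addV //; apply: Nle => //; exact: submx_trans NV VB.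
have [|r [Ns [Ns0 Nsr mono str w0]]] := IHn V _ sV ss1.
  rewrite -ltnS; apply: leq_trans ltn; rewrite ltnS ltn_sub2l //.
  by apply: leq_trans rNV (rank_leq_col _).
exists r.+1, (fun j => if j is j'.+1 then Ns j' else N); split=> //.
- by case=> [|j] //=; [rewrite Ns0 | exact: mono].
- by case=> [|j] //=; exact: str.
case=> [|[|j]] //= _ jr; last exact: w0.
(* A semistable [B/N] with [B] strictly between [N] and [V] would contradict the minimal rank of
   [V]. *)
rewrite Ns0; apply: W0_subquot => // B sB NB BV BN VB ssB.
by have := ltn_rank BV VB; rewrite ltnNge minV.
Qed.

End Semistable.

(** * Finiteness of the functions on strict quotients, and the filtration along a green path *)

Section Path.
Variables (F : fieldType) (A : falgType F) (X : module A) (G : module A -> Prop).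
Variable theta : R -> module A -> R.
Hypotheses (tG : torsion_class G) (mX : is_module X).
Implicit Types B C N V : 'M[F]_(mdim X).

(** Induction on a bound for the dimension of [W/U]. If a stable [V] lies strictly between, each
    [C/U] splits into a piece below [V] and one above; otherwise [C] has the row space of [U] or of
    [W]. *)
Lemma subquot_finite (theta_add : forall t, Defs.additive (theta t)) n (U W : 'M[F]_(mdim X)) :
  stable U -> stable W -> (U <= W)%MS -> (\rank W <= \rank U + n)%nat ->
  exists l : list (R -> R), forall C, stable C -> (U <= C)%MS -> (C <= W)%MS ->
    exists2 g, List.In g l & forall t, theta t (subquot C U) = g t.
Proof.
elim: n U W => [|n IHn] U W sU sW UW rW.
  exists (cons (fun _ => R0) nil) => C sC UC CW; exists (fun _ => R0); first by left.
  move=> t; apply: (additive_subquot0 mX (theta_add t)) => //; rewrite UC /=.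
  apply: submx_trans CW _; rewrite addn0 in rW.
  by apply: contraLR rW => WU; rewrite -ltnNge ltn_rank.
have [[V [sV [UV VW VU WV]]]|simple] := classic (exists V, stable V /\
    [/\ (U <= V)%MS, (V <= W)%MS, ~~ (V <= U)%MS & ~~ (W <= V)%MS]).
  have rUV := ltn_rank UV VU; have rVW := ltn_rank VW WV.
  have [|l1 Hl1] := IHn U V sU sV UV.
    by rewrite -ltnS; apply: leq_trans rVW _; rewrite -addnS.
  have [|l2 Hl2] := IHn V W sV sW VW.
    by apply: leq_trans rW _; rewrite addnS -addSn leq_add2r.
  exists (List.map (fun gh t => Rplus (fst gh t) (snd gh t)) (List.list_prod l1 l2)).
  move=> C sC UC CW.
  have sCV := stable_cap sC sV; have sCaV := stable_add sC sV.
  have [|g g1 Hg] := Hl1 _ sCV _ (capmxSr C V); first by rewrite sub_capmx UC.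
  have [|h h2 Hh] := Hl2 _ sCaV (addsmxSr C V); first by rewrite addsmx_sub CW.
  (* [g] is the function of [(C :&: V)/U] and [h] that of [(C + V)/V], which is isomorphic to
     [C/(C :&: V)]. *)
  exists (fun t => Rplus (g t) (h t)).
    by apply/List.in_map_iff; exists (g, h); split=> //; apply: List.in_prod.
  move=> t; rewrite -Hg -Hh -(additive_second mX (theta_add t) sC sV).
  apply: (additive_subquot mX (theta_add t)) => //; last exact: capmxSl.
  by rewrite sub_capmx UC.
exists (cons (fun _ => R0) (cons (fun t => theta t (subquot W U)) nil)) => C sC UC CW.
have [CU|CU] := boolP (C <= U)%MS.
  exists (fun _ => R0) => [|t]; first by left.
  by apply: (additive_subquot0 mX (theta_add t)) => //; rewrite UC.
have WC : (W <= C)%MS by apply: contraT => WC; case: simple; exists C.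
exists (fun t => theta t (subquot W U)) => [|t]; first by right; left.
rewrite (additive_subquot mX (theta_add t) sW sC sU UC CW).
by rewrite (additive_subquot0 mX (theta_add t) sW sC) ?CW // Rplus_0_r.
Qed.

Hypotheses (GX : G X) (green : smooth_green_path G theta).

(** These [C] index the nonzero quotients [N/C] whose positivity is followed along the path. *)
Definition proper_strict N C : Prop := [/\ strict_sub G C, (C <= N)%MS & ~~ (N <= C)%MS].

Lemma green_step N : strict_sub G N -> ~~ (N <= (0 : 'M_(mdim X)))%MS ->
  exists t1 C, [/\ proper_strict N C, semistable G (theta t1) N C,
    forall t, all_pos (proper_strict N) (fun C t => theta t (subquot N C)) t -> Rlt t1 t
    & all_pos (proper_strict C) (fun D t => theta t (subquot C D)) t1].
Proof.
case: green => add smooth dpos [T HT] [T' HT'] sN N0.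
have stN := strict_stable sN; have s0 := @stable0 _ _ X.
have mod_quo C : proper_strict N C -> is_module (subquot N C).
  by case=> sC CN _; apply: subquot_is_module => //; exact: (strict_stable sC).
have G_quo C : proper_strict N C -> G (subquot N C).
  by case=> sC CN _; exact: strict_torsion_quo.
have nz_quo C : proper_strict N C -> Defs.nonzero (subquot N C).
  by case=> sC CN NC; apply/(nonzeroP (presents_subquot stN CN)).
have addN C V t : strict_sub G C -> strict_sub G V -> (C <= V)%MS -> (V <= N)%MS ->
    theta t (subquot N C) = Rplus (theta t (subquot V C)) (theta t (subquot N V)).
  by move=> sC sV; exact: (additive_subquot mX (add t) stN (strict_stable sV) (strict_stable sC)).
pose f C t := theta t (subquot N C).
have [l Hl] := subquot_finite add s0 stN (sub0mx _ _) (leq_addl _ _).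
(* The list [l] covers the submodules [C] of [N]; the value on [N/C] is that on [N] minus that on
   [C]. *)
have f_fin C : proper_strict N C ->
    exists2 g, List.In g (List.map (fun g t => Rminus (theta t (sub N)) (g t)) l)
      & forall t, f C t = g t.
  case=> sC CN _; have [g gl Hg] := Hl C (strict_stable sC) (sub0mx _ _) CN.
  exists (fun t => Rminus (theta t (sub N)) (g t)).
    by apply/List.in_map_iff; exists g.
  move=> t; rewrite -Hg /f /sub (addN _ C t (strict_sub0 tG mX GX)) ?sub0mx //; lra.
have f_der C t : proper_strict N C -> ex_derive (f C) t.
  by move=> /mod_quo mQ; exact: (smooth _ mQ 1%nat t).
(* Since [N/C] has value 0, that of [V/C] is minus that of [N/V], hence at most 0. *)
have ss C t : proper_strict N C -> (forall D, proper_strict N D -> Rle R0 (f D t)) ->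
    f C t = R0 -> semistable G (theta t) N C.
  move=> [sC CN _] nn fC; split=> // V sV CV VN.
  have := addN C V t sC sV CV VN; rewrite -/(f C t) fC.
  have [NV|NV] := boolP (N <= V)%MS.
    rewrite (additive_subquot0 mX (add t) stN (strict_stable sV)) ?VN //; lra.
  have := nn V; rewrite /f => /(_ (And3 sV VN NV)); lra.
have f_green C t : proper_strict N C -> (forall D, proper_strict N D -> Rle R0 (f D t)) ->
    f C t = R0 -> Rlt R0 (Derive (f C) t).
  move=> PC nn fC; have [sC CN _] := PC; apply: dpos; [exact: mod_quo | exact: G_quo | exact: nz_quo |].
  by have [_] := W_subquot tG mX (add t) sN sC CN (ss C t PC nn fC).
have P0 : proper_strict N 0 by split; [exact: strict_sub0 | exact: sub0mx |].
(* [T' - 1] is a time strictly before [T'], where [N/0] is negative. *)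
have [||t1 [nn [C0 [PC0 fC0]] first]] := last_zero f_fin f_der f_green (T := T) (T' := Rminus T' 1).
- by exists 0; split=> //; apply: HT'; [lra | exact: mod_quo | exact: G_quo | exact: nz_quo].
- by move=> t Tt C PC; apply: HT; [lra | exact: mod_quo | exact: G_quo | exact: nz_quo].
have [|C [PC fC] minC] := @ex_min_rank _ _ (fun C => proper_strict N C /\ f C t1 = R0).
  by exists C0.
exists t1, C; split=> //; first exact: ss.
(* As [N/C] vanishes at [t1], [C/D] and [N/D] have the same value there; if it were 0, [D] would
   contradict the minimal rank of [C]. *)
move=> D [sD DC CD]; have [sC CN NC] := PC.
have := addN D C t1 sD sC DC CN; rewrite -/(f C t1) fC -/(f D t1) => E.
have PD : proper_strict N D.
  by split=> //; [exact: submx_trans DC CN | apply: contra NC => ND; exact: submx_trans ND DC].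
have := nn D PD; case/Rle_lt_or_eq_dec; first lra.
move=> /esym fD; have := minC D (conj PD fD).
by rewrite leqNgt ltn_rank.
Qed.

(** The final clause strengthens the induction: all nonzero strict quotients of [C] are positive at
    [t1], so the first time attached to [C] is below [t1]. *)
Lemma green_filtration N : strict_sub G N ->
  exists (m : nat) (ts : nat -> R) (Ms : nat -> 'M[F]_(mdim X)),
    (forall k, (1 <= k)%nat -> (k < m)%nat -> Rgt (ts k) (ts k.+1)) /\
    [/\ Ms 0%nat = N, (Ms m == (0 : 'M_(mdim X)))%MS,
        forall k, (k < m)%nat -> (Ms k.+1 <= Ms k)%MS,
        forall k, (k <= m)%nat -> strict_sub G (Ms k)
      & (forall k, (1 <= k)%nat -> (k <= m)%nat -> W G (theta (ts k)) (subquot (Ms k.-1) (Ms k))) /\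
        (forall t, all_pos (proper_strict N) (fun C t => theta t (subquot N C)) t ->
          (1 <= m)%nat -> Rlt (ts 1%nat) t)].
Proof.
have [n] := ubnP (\rank N); elim: n N => // n IHn N rN sN.
have [N0|N0] := boolP (N <= (0 : 'M_(mdim X)))%MS.
  exists 0%nat, (fun _ => R0), (fun _ => N); split; first by case=> [|[]].
  split=> //; first by rewrite N0 sub0mx.
  by split=> //; case.
have [t1 [C [[sC CN NC] ss first posC]]] := green_step sN N0.
have rC := ltn_rank CN NC.
have [|m [ts [Ms [dec [Ms0 Msm mono str [w bound]]]]]] := IHn C _ sC.
  by apply: leq_trans rC _.
(* Times are indexed from 1, so index 0 carries a dummy value and [t1] sits at index 1, while the
   submodules start at index 0 with [N]. *)
exists m.+1, (fun k => if k is k'.+2 then ts k'.+1 else t1),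
  (fun k => if k is k'.+1 then Ms k' else N).
split.
  case=> [|[|k]] //= _ km; first exact: bound.
  exact: dec.
split=> //.
- by case=> [|k] //= km; [rewrite Ms0 | exact: mono].
- by case=> [|k] //= km; exact: str.
split=> [|t post _]; last exact: first.
case=> [|[|k]] //= _ km; last exact: w.
rewrite Ms0; apply: W_subquot => //.
by case: green => add *; exact: add.
Qed.

End Path.

Theorem mainTheorem18 (F : fieldType) (A : falgType F)
  (G : module A -> Prop) (theta : R -> module A -> R) (M : module A) :
  torsion_class G -> smooth_green_path G theta -> G M ->
  exists (m : nat) (ts : nat -> R) (Ms : nat -> 'M[F]_(mdim M)),
    (forall k : nat, (1 <= k)%nat -> (k < m)%nat -> Rgt (ts k) (ts k.+1)) /\
    [/\ (Ms 0%nat == 1%:M)%MS, (Ms m == (0 : 'M_(mdim M)))%MS,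
        forall k : nat, (k < m)%nat -> (Ms k.+1 <= Ms k)%MS,
        forall k : nat, (k <= m)%nat -> strict_sub G (Ms k)
      & forall k : nat, (1 <= k)%nat -> (k <= m)%nat ->
          W G (theta (ts k)) (subquot (Ms k.-1) (Ms k)) /\
          exists (r : nat) (Ns : nat -> 'M[F]_(mdim (subquot (Ms k.-1) (Ms k)))),
            [/\ (Ns 0%nat == (0 : 'M_(mdim (subquot (Ms k.-1) (Ms k)))))%MS, (Ns r == 1%:M)%MS,
                forall j : nat, (j < r)%nat -> (Ns j <= Ns j.+1)%MS,
                forall j : nat, (j <= r)%nat -> strict_sub G (Ns j)
              & forall j : nat, (1 <= j)%nat -> (j <= r)%nat ->
                  W0 G (theta (ts k)) (subquot (Ns j) (Ns j.-1))]].
Proof.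
move=> tG green GM; have [Gmod _ _ _] := tG.
have [add _ _ _ _] := green.
have [m [ts [Ms [dec [Ms0 Msm mono str [w _]]]]]] :=
  green_filtration tG (Gmod _ GM) GM green (strict_sub1 tG (Gmod _ GM) GM).
exists m, ts, Ms; split=> //; split=> //; first by rewrite Ms0 submx_refl.
move=> k k0 km; have wk := w k k0 km; split=> //.
have [GQ _] := wk; have mQ := Gmod _ GQ.
(* The ambient module becomes the quotient itself, presented by the identity with [N] the whole
   module and [C] zero. *)
have ss := proj1 (WP tG mQ (strict_sub0 tG mQ GQ) (presents_self _) (strict_sub1 tG mQ GQ) (add (ts k))) wk.
have [r [Ns [Ns0 Nsr Nmono Nstr w0]]] :=
  semistable_chain tG mQ (add (ts k)) GQ (strict_sub0 tG mQ GQ) ss.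
by exists r, Ns; split=> //; rewrite Ns0 submx_refl.
Qed.
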